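(* (1) For every game structure $G$ and all states $s,t$ of $G$, $[s\preceq_1 t]\le[s\sqsubseteq_1 t]$. (2) There exist a game structure $G$ and states $s,t$ of $G$ with $[s\preceq_1 t]=0$ and $[s\sqsubseteq_1 t]>0$. (3) For every turn-based game structure, $[\preceq_1]=[\sqsubseteq_1]$.
   Context: A game structure $G=(S,[\cdot],\mathit{Moves},\Gamma_1,\Gamma_2,\delta)$: finite state set $S$; finite set $V$ of observation variables, each $v$ interpreted as $[v]:S\to[0,1]$; finite move set; $\Gamma_1,\Gamma_2:S\to2^{\mathit{Moves}}\setminus\{\emptyset\}$; $\delta:S\times\mathit{Moves}\times\mathit{Moves}\to\mathrm{Distr}(S)$. $G$ is turn-based if $S$ is the disjoint union of $S_1,S_2$ with $|\Gamma_2(s)|=1$ for $s\in S_1$, $|\Gamma_1(s)|=1$ for $s\in S_2$, and there is a variable $\mathit{turn}\in V$ with $[\mathit{turn}](s)=1$ iff $s\in S_1$ and $[\mathit{turn}](s)=0$ iff $s\in S_2$. Mixed moves $\mathcal{D}_i(s)=\mathrm{Distr}(\Gamma_i(s))$; $\delta(s,x_1,x_2)(u)=\sum_{a_1,a_2}\delta(s,a_1,a_2)(u)x_1(a_1)x_2(a_2)$. Valuations $k:S\to[0,1]$; $\mathrm{E}^{x_1,x_2}_s(k)=\sum_u\delta(s,x_1,x_2)(u)k(u)$; $\mathrm{Pre}_1(k)(s)=\sup_{x_1\in\mathcal{D}_1(s)}\inf_{x_2\in\mathcal{D}_2(s)}\mathrm{E}^{x_1,x_2}_s(k)$. Directed metrics: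 $d:S\times S\to\mathbb{R}_{\ge0}$, $d(s,s)=0$, triangle inequality; ordered pointwise. $C(d)=\{k:k(s)-k(t)\le d(s,t)\ \forall s,t\}$; $[s\equiv t]=\max_{v}|[v](s)-[v](t)|$; $\sqcup=\max$. $H_{\preceq_1}(d)(s,t)=[s\equiv t]\sqcup\sup_{k\in C(d)}(\mathrm{Pre}_1(k)(s)-\mathrm{Pre}_1(k)(t))$; $H_{\sqsubseteq_1}(d)(s,t)=[s\equiv t]\sqcup\sup_{x_1\in\mathcal{D}_1(s)}\inf_{y_1\in\mathcal{D}_1(t)}\sup_{y_2\in\mathcal{D}_2(t)}\inf_{x_2\in\mathcal{D}_2(s)}\sup_{k\in C(d)}(\mathrm{E}^{x_1,x_2}_s(k)-\mathrm{E}^{y_1,y_2}_t(k))$. $[\preceq_1]$ (a priori simulation metric) and $[\sqsubseteq_1]$ (a posteriori simulation metric) are the least fixpoints of $H_{\preceq_1}$, $H_{\sqsubseteq_1}$ in the lattice of directed metrics; $[s\preceq_1 t]=[\preceq_1](s,t)$ etc. *)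

(* Defs.v *)
From HB Require Import structures.
From mathcomp Require Import all_boot all_order all_algebra.
From mathcomp Require Import boolp classical_sets reals.

Set Implicit Arguments.
Unset Strict Implicit.
Unset Printing Implicit Defensive.

Import Order.TTheory GRing.Theory Num.Theory.

Local Open Scope classical_set_scope.
Local Open Scope ring_scope.

(* Distr(A), for A a subset of a finite type T: elements are extended by 0
   to all of T. *)
Definition distr (R : realType) (T : finType) (A : {pred T}) : set (T -> R) :=
  [set x | [/\ forall a, 0 <= x a,
               forall a, a \notin A -> x a = 0
             & \sum_a x a = 1]].

Record game_structure (R : realType) := GameStructure {
  state : finType;
  obsvar : finType;
  move : finType;
  obs : obsvar -> state -> R;
  Gamma1 : state -> {set move};
  Gamma2 : state -> {set move};
  delta : state -> move -> move -> state -> R;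
  obs_itv : forall v s, 0 <= obs v s <= 1;
  Gamma1_neq0 : forall s, Gamma1 s != finset.set0;
  Gamma2_neq0 : forall s, Gamma2 s != finset.set0;
  delta_distr : forall s a b, distr predT (delta s a b)
}.

Section Metrics.
Variables (R : realType) (G : game_structure R).
Local Notation S := (state G).
Local Notation M := (move G).
Implicit Types (s t u : S) (k : S -> R) (d : S -> S -> R).

Definition turn_based : Prop :=
  exists S1 S2 : {set S},
    [/\ (S1 :|: S2 = [set: S])%SET,
        (S1 :&: S2)%SET = finset.set0,
        forall s, s \in S1 -> #|Gamma2 s| = 1%N,
        forall s, s \in S2 -> #|Gamma1 s| = 1%N
      & exists turn : obsvar G, forall s,
          (obs turn s = 1 <-> s \in S1) /\ (obs turn s = 0 <-> s \in S2)].

Definition D1 s : set (M -> R) := distr (Gamma1 s).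
Definition D2 s : set (M -> R) := distr (Gamma2 s).

Definition mixed_delta s (x1 x2 : M -> R) u : R :=
  \sum_a1 \sum_a2 delta s a1 a2 u * x1 a1 * x2 a2.

Definition expect s (x1 x2 : M -> R) k : R :=
  \sum_u mixed_delta s x1 x2 u * k u.

Definition Pre1 k s : R :=
  sup [set inf [set expect s x1 x2 k | x2 in D2 s] | x1 in D1 s].

Definition directed_metric d : Prop :=
  [/\ forall s t, 0 <= d s t,
      forall s, d s s = 0
    & forall s t u, d s u <= d s t + d t u].

Definition C d : set (S -> R) :=
  [set k | (forall s, 0 <= k s <= 1) /\ (forall s t, k s - k t <= d s t)].

Definition obs_dist s t : R :=
  \big[Num.max/0]_(v : obsvar G) `|obs v s - obs v t|.

Definition H_priori d s t : R :=
  Num.max (obs_dist s t) (sup [set Pre1 k s - Pre1 k t | k in C d]).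

Definition H_posteriori d s t : R :=
  Num.max (obs_dist s t)
    (sup [set inf [set sup [set inf [set
       sup [set expect s x1 x2 k - expect t y1 y2 k | k in C d]
       | x2 in D2 s] | y2 in D2 t] | y1 in D1 t] | x1 in D1 s]).

Definition is_lfp (H : (S -> S -> R) -> S -> S -> R) d : Prop :=
  [/\ directed_metric d,
      H d = d
    & forall d', directed_metric d' -> H d' = d' ->
        forall s t, d s t <= d' s t].

(* The default value of xget is never used for the two operators above: both
   are monotone, preserve directed metrics and are bounded by 1, so that a
   least fixpoint exists (Knaster-Tarski on the directed metrics bounded
   by 1). *)
Definition lfp (H : (S -> S -> R) -> S -> S -> R) : S -> S -> R :=
  xget (fun _ _ => 0) (is_lfp H).

Definition priori_metric : S -> S -> R := lfp H_priori.

Definition posteriori_metric : S -> S -> R := lfp H_posteriori.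

End Metrics.

(* Main.v *)
(** Unfolding suprema and infima, [Pre1 k s - Pre1 k t <= m] says that for every
    [x1] and [e > 0] there is [y1] such that for every [y2] there is [x2] with
    [expect s x1 x2 k - expect t y1 y2 k <= m + e]. The a posteriori operator has
    the same form with [k] quantified innermost, so it dominates the a priori one,
    and so do the least fixpoints.

    In a turn-based game only one existentially chosen mixed move, [y1] or [x2],
    is nontrivial when [s] and [t] belong to the same player, and it can be moved
    in front of [k] by the minimax theorem, as the expectation is bilinear and
    [C d] is convex. If [s] and [t] belong to different players, the variable
    [turn] already forces distance 1.

    In a concurrent game the exchange fails, because for fixed [y1] the quantity
    [inf_y2 expect t y1 y2 k] is concave, not convex, in [k]. *)

Require Import Defs.
From mathcomp Require Import all_boot all_order all_algebra.
From mathcomp Require Import boolp classical_sets reals.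
From mathcomp Require Import ring lra.

Set Implicit Arguments.
Unset Strict Implicit.
Unset Printing Implicit Defensive.

Import Order.TTheory GRing.Theory Num.Theory.
Local Open Scope ring_scope.
Local Open Scope classical_set_scope.

(** * Suprema and infima of bounded images *)

Section SupInf.
Variables (R : realType) (T : Type).
Implicit Types (A : set T) (F : T -> R) (l u m : R).

Lemma le_sup_image A F u x :
  (forall y, A y -> F y <= u) -> A x -> F x <= sup [set F y | y in A].
Proof.
move=> Fu Ax; apply: ub_le_sup; last by exists x.
by exists u => _ [y Ay <-]; exact: Fu.
Qed.

Lemma ge_inf_image A F l x :
  (forall y, A y -> l <= F y) -> A x -> inf [set F y | y in A] <= F x.
Proof.
move=> Fl Ax; apply: ge_inf; last by exists x.
by exists l => _ [y Ay <-]; exact: Fl.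
Qed.

Lemma sup_image_le A F m :
  A !=set0 -> (forall x, A x -> F x <= m) -> sup [set F x | x in A] <= m.
Proof.
move=> [x Ax] Fm; apply: ge_sup; first by exists (F x), x.
by move=> _ [y Ay <-]; exact: Fm.
Qed.

Lemma inf_image_ge A F m :
  A !=set0 -> (forall x, A x -> m <= F x) -> m <= inf [set F x | x in A].
Proof.
move=> [x Ax] Fm; apply: lb_le_inf; first by exists (F x), x.
by move=> _ [y Ay <-]; exact: Fm.
Qed.

Lemma sup_image_adherent A F u e :
  A !=set0 -> (forall x, A x -> F x <= u) -> 0 < e ->
  exists2 x, A x & sup [set F x | x in A] - e < F x.
Proof.
move=> [x Ax] Fu e0.
have [|_ [y Ay <-] lty] := @sup_adherent _ [set F x | x in A] _ e0.
  by split; [exists (F x), x | exists u => _ [y Ay <-]; exact: Fu].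
by exists y.
Qed.

Lemma inf_image_adherent A F l e :
  A !=set0 -> (forall x, A x -> l <= F x) -> 0 < e ->
  exists2 x, A x & F x < inf [set F x | x in A] + e.
Proof.
move=> [x Ax] Fl e0.
have [|_ [y Ay <-] lty] := @inf_adherent _ [set F x | x in A] _ e0.
  by split; [exists (F x), x | exists l => _ [y Ay <-]; exact: Fl].
by exists y.
Qed.

Lemma sup_image_itv A F l u : A !=set0 ->
  (forall x, A x -> l <= F x <= u) -> l <= sup [set F x | x in A] <= u.
Proof.
move=> A0 Flu; have Fu x : A x -> F x <= u by move=> /Flu /andP[].
rewrite sup_image_le // andbT; case: A0 => x Ax.
by apply: le_trans (le_sup_image Fu Ax); case/andP: (Flu x Ax).
Qed.

Lemma inf_image_itv A F l u : A !=set0 ->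
  (forall x, A x -> l <= F x <= u) -> l <= inf [set F x | x in A] <= u.
Proof.
move=> A0 Flu; have Fl x : A x -> l <= F x by move=> /Flu /andP[].
rewrite inf_image_ge //=; case: A0 => x Ax.
by apply: le_trans (ge_inf_image Fl Ax) _; case/andP: (Flu x Ax).
Qed.

End SupInf.

(** * Distributions and the minimax theorem *)

Section Distributions.
Variables (R : realType) (T : finType).
Implicit Types (A : {pred T}) (x : T -> R).

Definition dirac (a : T) : T -> R := fun b => (b == a)%:R.

Lemma sum_dirac (a : T) (f : T -> R) : \sum_b dirac a b * f b = f a.
Proof.
rewrite (bigD1 a) //= /dirac eqxx mul1r big1 ?addr0 // => b /negPf->.
by rewrite mul0r.
Qed.

Lemma distr_dirac A a : a \in A -> distr A (dirac a).
Proof.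
move=> aA; split=> [b|b bA|]; rewrite /dirac ?ler0n //.
  by case: eqP bA => // ->; rewrite aA.
by under eq_bigr do rewrite -[_%:R]mulr1; rewrite (sum_dirac a (fun=> 1)).
Qed.

Lemma distr_neq0 (A : {set T}) : A != finset.set0 -> distr (R := R) A !=set0.
Proof. by case/set0Pn => a aA; exists (dirac a); exact: distr_dirac. Qed.

Lemma distr_mix A x y p : distr A x -> distr A y -> 0 <= p <= 1 ->
  distr A (fun a => p * x a + (1 - p) * y a).
Proof.
move=> [x0 xA x1] [y0 yA y1] /andP[p0 p1]; split=> [a|a aA|].
- by rewrite addr_ge0 ?mulr_ge0 ?subr_ge0.
- by rewrite xA // yA // !mulr0 addr0.
- by rewrite big_split -!mulr_sumr /= x1 y1; ring.
Qed.

Lemma distr_sub A (B : {pred T}) x : {subset A <= B} -> distr A x -> distr B x.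
Proof.
move=> AB [x0 xA x1]; split=> // a aB; apply: xA.
by apply: contra aB => /AB.
Qed.

(** In a turn-based game this removes the mixed moves of the player who has no choice. *)
Lemma distr_card1_unique (A : {set T}) x y :
  #|A| = 1%N -> distr A x -> distr A y -> x = y.
Proof.
move=> /eqP/cards1P[a ->] [_ xA x1] [_ yA y1].
have supp z : (forall b, b \notin [set a]%SET -> z b = 0) ->
    \sum_b z b = 1 -> z = dirac a.
  move=> zA z1; apply/funext => b; rewrite /dirac; case: eqP => [->|/eqP ba].
    rewrite -z1 (bigD1 a) //= big1 ?addr0 // => c ca.
    by rewrite zA // inE.
  by rewrite zA // inE.
by rewrite (supp x) // (supp y).
Qed.

(** Otherwise the terms [x a * (f a - c)] are nonnegative with sum at most 0, so they all vanish,
    forcing [x = 0] against total mass 1. This turns mixed replies into pure ones. *)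
Lemma distr_mean_le A x (f : T -> R) c :
  distr A x -> \sum_a x a * f a <= c -> exists2 a, a \in A & f a <= c.
Proof.
move=> [x0 xA x1] fc; apply: contrapT => nofa.
have fgt a : a \in A -> c < f a.
  by move=> aA; rewrite ltNge; apply/negP => fac; apply: nofa; exists a.
have sum0 : \sum_a x a * (f a - c) = 0.
  apply/eqP; rewrite eq_le; apply/andP; split.
    under eq_bigr do rewrite mulrBr.
    by rewrite sumrB -mulr_suml x1 mul1r subr_le0.
  apply: sumr_ge0 => a _; case: (boolP (a \in A)) => aA.
    by rewrite mulr_ge0 // subr_ge0 ltW // fgt.
  by rewrite xA // mul0r.
have x_eq0 a : x a = 0.
  case: (boolP (a \in A)) => aA; last exact: xA.
  have /psumr_eq0P : forall b, true -> 0 <= x b * (f b - c).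
    move=> b _; case: (boolP (b \in A)) => bA; last by rewrite xA // mul0r.
    by rewrite mulr_ge0 // subr_ge0 ltW // fgt.
  move=> /(_ sum0 a isT) /eqP; rewrite mulf_eq0 subr_eq0 => /orP[/eqP//|/eqP fa].
  by have := fgt a aA; rewrite fa ltxx.
by move: x1; under eq_bigr do rewrite x_eq0; rewrite big1 // => /eqP;
  rewrite eq_sym oner_eq0.
Qed.

End Distributions.

(** * Minimax for finitely many functions on a convex set *)

Section Minimax.
Variables (R : realType) (X : Type).
Implicit Types (K : set X).

(** [X] has no linear structure, so convexity of [K] and affinity of the functions are stated
    together: one point [m] realises the mixed values of all [g i] at once. *)
Definition convexlike (I : Type) K (g : I -> X -> R) : Prop :=
  forall k l p, K k -> K l -> 0 <= p <= 1 ->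
    exists2 m, K m & forall i, g i m = p * g i k + (1 - p) * g i l.

(* Otherwise both functions are positive somewhere on the segment from [k] to [l]. *)
Lemma convexlike_cross K (g : bool -> X -> R) k l :
  convexlike K g -> (forall m, K m -> g true m <= 0 \/ g false m <= 0) ->
  K k -> K l -> 0 < g true k -> 0 < g false l ->
  g false l * g true k <= g false k * g true l.
Proof.
move=> gK gle Kk Kl gk hl.
have hk : g false k <= 0 by case: (gle k Kk) => //; lra.
have gl : g true l <= 0 by case: (gle l Kl) => //; lra.
rewrite leNgt; apply/negP => lt_cross.
(* The mediant of the two admissible ratios lies strictly between them. *)
pose N := g false l - g true l + (g true k - g false k).
have N0 : 0 < N by rewrite /N; lra.
have [] := gK k l ((g false l - g true l) / N) Kk Kl.
  by rewrite divr_ge0 ?ler_pdivrMr ?mul1r ?ltW //= /N; lra.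
move=> m Km gm.
(* The chosen weight makes both functions take the same value at [m]; if positive, it violates the
   hypothesis. *)
have gE b : g b m = (g false l * g true k - g false k * g true l) / N.
  rewrite gm; case: b; rewrite /N; field; exact: lt0r_neq0 N0.
have pos : 0 < (g false l * g true k - g false k * g true l) / N.
  by rewrite divr_gt0 // subr_gt0.
by case: (gle m Km); rewrite gE leNgt pos.
Qed.

(** With [p = r / (1 + r)] the goal reads [r * g true k + g false k <= 0]. Points where [g false] is
    positive bound [r] from below, points where [g true] is positive bound it from above, and
    [convexlike_cross] puts every lower bound below every upper one. So the supremum of the lower
    bounds works. *)
Lemma minimax2 K (g : bool -> X -> R) :
  convexlike K g -> (forall m, K m -> g true m <= 0 \/ g false m <= 0) ->
  exists2 p, 0 <= p <= 1 & forall k, K k -> p * g true k + (1 - p) * g false k <= 0.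
Proof.
move=> gK gle.
have [[k0 Kk0 gk0]|nogt] := pselect (exists2 k, K k & 0 < g true k); last first.
  exists 1 => [|k Kk]; first by rewrite ler01 lexx.
  rewrite mul1r subrr mul0r addr0 leNgt; apply/negP => gk.
  by apply: nogt; exists k.
have [[l0 Kl0 hl0]|nogt] := pselect (exists2 k, K k & 0 < g false k); last first.
  exists 0 => [|k Kk]; first by rewrite ler01 lexx.
  rewrite mul0r subr0 mul1r add0r leNgt; apply/negP => gk.
  by apply: nogt; exists k.
have cross := convexlike_cross gK gle.
(* The cross inequality against [k0] has a positive left side, so [g true l] cannot be 0 and [q] may
   divide by it. *)
have neg l : K l -> 0 < g false l -> g true l < 0.
  move=> Kl hl; have := cross _ _ Kk0 Kl gk0 hl.
  have : 0 < g false l * g true k0 by rewrite mulr_gt0.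
  by case: (gle l Kl); case: (gle k0 Kk0); nra.
pose L := [set l | K l /\ 0 < g false l].
pose q l := g false l / - g true l.
have q_le k l : K k -> 0 < g true k -> L l -> q l <= - g false k / g true k.
  move=> Kk gk [Kl hl]; have gl := neg l Kl hl; have := cross _ _ Kk Kl gk hl.
  rewrite /q ler_pdivlMr // mulrAC ler_pdivrMr ?oppr_gt0 //; lra.
have Ll0 : L l0 by [].
have L0 : L !=set0 by exists l0.
pose r := sup [set q l | l in L].
have r_ge l : L l -> q l <= r.
  by move=> Ll; apply: (le_sup_image _ Ll) => y Ly; exact: (q_le k0).
have r0 : 0 <= r.
  apply: le_trans (r_ge _ Ll0); rewrite /q divr_ge0 // ?oppr_ge0 ltW //.
  exact: neg.
exists (r / (1 + r)) => [|k Kk].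
  by rewrite divr_ge0 ?ler_pdivrMr ?mul1r //=; lra.
have -> : r / (1 + r) * g true k + (1 - r / (1 + r)) * g false k =
    (r * g true k + g false k) / (1 + r) by field; lra.
rewrite pmulr_lle0 ?invr_gt0; last by lra.
have [gk|gk] := ltP 0 (g true k).
  have : r <= - g false k / g true k.
    by apply: sup_image_le => // l Ll; exact: q_le.
  by rewrite ler_pdivlMr //; lra.
have [hk|hk] := ltP 0 (g false k); last by nra.
have := r_ge k (conj Kk hk).
by rewrite /q ler_pdivrMr ?oppr_gt0 ?neg //; lra.
Qed.

(* By induction, on the part of [K] where [g a] is positive some mixture of the
   other functions is nonpositive; [minimax2] then mixes it with [g a]. *)
Lemma minimax_seq (T : finType) (r : seq T) K (g : T -> X -> R) :
  r != [::] -> convexlike K g ->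
  (forall k, K k -> exists2 a, a \in r & g a k <= 0) ->
  exists2 x, distr (mem r) x & forall k, K k -> \sum_a x a * g a k <= 0.
Proof.
elim: r K => // a r IHr K _ gK gle.
have [r0|rn0] := eqVneq r [::].
  exists (dirac R a) => [|k Kk]; first by apply: distr_dirac; exact: mem_head.
  rewrite (sum_dirac a (g^~ k)); have [b] := gle k Kk.
  by rewrite r0 inE => /eqP->.
have [|k [Kk gk]|x xr xle] := IHr [set k | K k /\ 0 < g a k] rn0.
(* Positivity of [g a] survives mixing, so the restricted set is again convexlike. *)
- move=> k l p [Kk gk] [Kl gl] p01; have [m Km gm] := gK k l p Kk Kl p01.
  exists m => //; split=> //; rewrite gm.
  case/andP: p01 => p0 p1; have [->|pn0] := eqVneq p 0; first by lra.
  have {pn0}p0 : 0 < p by rewrite lt0r pn0.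
  by rewrite ltr_pwDl ?mulr_gt0 // mulr_ge0 ?subr_ge0 // ltW.
- have [b] := gle k Kk; rewrite inE => /orP[/eqP->|br gb]; last by exists b.
  by rewrite leNgt gk.
pose h b k := if b then g a k else \sum_b x b * g b k.
have [||p p01 ple] := @minimax2 K h.
- move=> k l p Kk Kl p01; have [m Km gm] := gK k l p Kk Kl p01.
  exists m => // -[]; rewrite /h //.
  rewrite !mulr_sumr -big_split /=; apply: eq_bigr => b _.
  by rewrite gm; ring.
- move=> k Kk; have [gk|gk] := leP (g a k) 0; first by left.
  by right; exact: xle.
exists (fun b => p * dirac R a b + (1 - p) * x b).
  apply: distr_mix => //; first by apply: distr_dirac; exact: mem_head.
  by apply: distr_sub xr => b br; rewrite !inE; apply/orP; right.
move=> k Kk; apply: le_trans (ple k Kk).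
rewrite /h -(sum_dirac a (g^~ k)) !mulr_sumr -big_split /=.
by apply: ler_sum => b _; rewrite mulrDl !mulrA.
Qed.

(** A mean at most [c] forces some pure move to achieve [c], which is the hypothesis of
    [minimax_seq] for [g a - c]; mass 1 brings [c] back out of the sum. *)
Lemma minimax (T : finType) (A : {set T}) K (g : T -> X -> R) c :
  A != finset.set0 -> convexlike K g ->
  (forall k, K k -> exists2 x, distr A x & \sum_a x a * g a k <= c) ->
  exists2 x, distr A x & forall k, K k -> \sum_a x a * g a k <= c.
Proof.
move=> A0 gK gle.
have [|||x xA xle] := @minimax_seq T (enum A) K (fun a k => g a k - c).
- by apply: contraNneq A0 => A0; apply/eqP/finset.setP => a;
    rewrite -mem_enum A0 !inE.
- move=> k l p Kk Kl p01; have [m Km gm] := gK k l p Kk Kl p01.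
  by exists m => // a; rewrite gm; ring.
- move=> k Kk; have [x xA /(distr_mean_le xA)[a aA ga]] := gle k Kk.
  by exists a; rewrite ?mem_enum // subr_le0.
exists x => [|k Kk]; first by apply: distr_sub xA => a; rewrite mem_enum.
have := xle k Kk; have [_ _ x1] := xA; under eq_bigr do rewrite mulrBr.
by rewrite sumrB -mulr_suml x1 mul1r subr_le0.
Qed.

End Minimax.

(** * Least fixpoints of operators on directed metrics *)

Section LeastFixpoint.
Variables (R : realType) (G : game_structure R).
Local Notation S := (state G).
Implicit Types (d p : S -> S -> R) (H : (S -> S -> R) -> S -> S -> R).

(** The join of the Knaster-Tarski argument; the bound 1 keeps the suprema finite. *)
Lemma directed_metric_sup (P : set (S -> S -> R)) :
  P !=set0 -> (forall d, P d -> directed_metric d) ->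
  (forall d, P d -> forall s t, d s t <= 1) ->
  directed_metric (fun s t => sup [set d s t | d in P]).
Proof.
move=> P0 Pdm P1.
have ub s t d : P d -> d s t <= sup [set d s t | d in P].
  by move=> Pd; apply: (@le_sup_image _ _ P (fun d => d s t) 1) => // e /P1.
have [d0 Pd0] := P0; split=> [s t|s|s t u].
- by apply: le_trans (ub _ _ _ Pd0); case: (Pdm _ Pd0).
- apply/eqP; rewrite eq_le; apply/andP; split.
    by apply: sup_image_le => // d /Pdm[_ -> _].
  by apply: le_trans (ub _ _ _ Pd0); case: (Pdm _ Pd0) => _ ->.
- apply: sup_image_le => // d Pd; have [_ _ tri] := Pdm _ Pd.
  by apply: le_trans (tri s t u) _; apply: lerD; exact: ub.
Qed.

(** The largest directed metric with values at most 1, hence a prefixpoint of every operator bounded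
    by 1. *)
Definition discrete_metric : S -> S -> R := fun s t => (s != t)%:R.

Lemma directed_metric_discrete : directed_metric discrete_metric.
Proof.
rewrite /discrete_metric; split=> [s t|s|s t u]; rewrite ?ler0n ?eqxx //.
have [->|_] := eqVneq s t; first by rewrite add0r.
by rewrite (le_trans (_ : _ <= 1)) ?lerDl ?ler0n // lern1 leq_b1.
Qed.

Definition metric_operator H : Prop :=
  [/\ forall d, directed_metric d -> directed_metric (H d),
      forall d p, directed_metric d -> directed_metric p ->
        (forall s t, d s t <= p s t) -> forall s t, H d s t <= H p s t
    & forall d, directed_metric d -> forall s t, H d s t <= 1].

Lemma exists_least_prefixpoint H : metric_operator H ->
  exists d, [/\ directed_metric d, H d = d
    & forall p, directed_metric p -> (forall s t, H p s t <= p s t) ->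
        forall s t, d s t <= p s t].
Proof.
move=> [Hdm Hmono H1].
pose pre p := directed_metric p /\ forall s t, H p s t <= p s t.
have pre_discrete : pre discrete_metric.
  split=> [|s t]; first exact: directed_metric_discrete.
  have dm := directed_metric_discrete; have [->|st] := eqVneq s t.
    by have [_ -> _] := Hdm _ dm; case: dm.
  by rewrite {2}/discrete_metric st; exact: H1.
(* Infima of directed metrics are not pointwise, so the meet of the prefixpoints
   is obtained as the join of the metrics below all of them. *)
pose P := [set d | directed_metric d /\
  forall p, pre p -> forall s t, d s t <= p s t].
have P0 : P !=set0.
  exists (fun _ _ => 0); split=> [|p [[p0 _ _] _]] //.
  by split=> // *; rewrite addr0.
have P1 d : P d -> forall s t, d s t <= 1.
  move=> [_ dle] s t; apply: le_trans (dle _ pre_discrete s t) _.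
  by rewrite /discrete_metric lern1 leq_b1.
pose m s t := sup [set d s t | d in P].
have m_dm : directed_metric m by apply: directed_metric_sup => // d [].
have m_le p : pre p -> forall s t, m s t <= p s t.
  by move=> pre_p s t; apply: sup_image_le => // d [_]; exact.
have le_m d : P d -> forall s t, d s t <= m s t.
  by move=> Pd s t; apply: (@le_sup_image _ _ P (fun d => d s t) 1) => // e /P1.
have Hm_le s t : H m s t <= m s t.
  apply: le_m; split=> [|p pre_p s' t']; first exact: Hdm.
  have [p_dm ple] := pre_p; apply: le_trans (ple s' t').
  by apply: Hmono => // s'' t''; exact: m_le.
exists m; split=> // [|p p_dm ple]; last exact: m_le.
apply/funext => s; apply/funext => t; apply/eqP; rewrite eq_le Hm_le /=.
(* By monotonicity [H m] is itself a prefixpoint, so [m] lies below it. *)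
apply: m_le; split=> [|s' t']; first exact: Hdm.
by apply: Hmono => //; exact: Hdm.
Qed.

(** Existence rules out the default of [xget]. The least prefixpoint is a fixpoint, so [lfp H] lies
    below it; this gives the induction principle in the second conjunct. *)
Lemma lfp_spec H : metric_operator H ->
  is_lfp H (lfp H) /\ forall p, directed_metric p ->
    (forall s t, H p s t <= p s t) -> forall s t, lfp H s t <= p s t.
Proof.
move=> /exists_least_prefixpoint[m [m_dm Hm m_le]].
have lfpP : is_lfp H (lfp H).
  apply: xgetPex; exists m; split=> // p p_dm Hp.
  by apply: m_le => // s t; rewrite Hp.
split=> // p p_dm ple s t; apply: le_trans (m_le p p_dm ple s t).
by case: lfpP => _ _ lfp_le; exact: lfp_le.
Qed.

(** The least fixpoint of [H2] is a prefixpoint of [H1]. *)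
Lemma lfp_le H1 H2 : metric_operator H1 -> metric_operator H2 ->
  (forall d, directed_metric d -> forall s t, H1 d s t <= H2 d s t) ->
  forall s t, lfp H1 s t <= lfp H2 s t.
Proof.
move=> H1op /lfp_spec[[dm2 fix2 _] _] H12.
have [_] := lfp_spec H1op; apply=> // s t.
by rewrite -{2}fix2; exact: H12.
Qed.

End LeastFixpoint.

(** * The two operators *)

Section Operators.
Variables (R : realType) (G : game_structure R).
Local Notation S := (state G).
Local Notation M := (move G).
Implicit Types (s t u : S) (k : S -> R) (d : S -> S -> R) (x y : M -> R).

Lemma D1_neq0 s : D1 s !=set0.
Proof. exact/distr_neq0/Gamma1_neq0. Qed.

Lemma D2_neq0 s : D2 s !=set0.
Proof. exact/distr_neq0/Gamma2_neq0. Qed.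

(** Fixing one player's pure move displays [expect] as a mean over that player's moves, the form
    that [minimax] takes. *)
Definition expect1 s a x2 k : R :=
  \sum_u \sum_b delta s a b u * x2 b * k u.

Definition expect2 s x1 b k : R :=
  \sum_u \sum_a delta s a b u * x1 a * k u.

Lemma expectE1 s x1 x2 k : expect s x1 x2 k = \sum_a x1 a * expect1 s a x2 k.
Proof.
rewrite /expect /mixed_delta /expect1.
under [RHS]eq_bigr do rewrite mulr_sumr; rewrite [RHS]exchange_big /=.
apply: eq_bigr => u _; rewrite mulr_suml; apply: eq_bigr => a _.
by rewrite mulr_suml mulr_sumr; apply: eq_bigr => b _; ring.
Qed.

Lemma expectE2 s x1 x2 k : expect s x1 x2 k = \sum_b x2 b * expect2 s x1 b k.
Proof.
rewrite /expect /mixed_delta /expect2.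
under [RHS]eq_bigr do rewrite mulr_sumr; rewrite [RHS]exchange_big /=.
apply: eq_bigr => u _; rewrite exchange_big mulr_suml; apply: eq_bigr => b _.
by rewrite mulr_suml mulr_sumr; apply: eq_bigr => a _; ring.
Qed.

Lemma expect1_mix s a x2 k l p :
  expect1 s a x2 (fun u => p * k u + (1 - p) * l u) =
  p * expect1 s a x2 k + (1 - p) * expect1 s a x2 l.
Proof.
rewrite /expect1 !mulr_sumr -big_split; apply: eq_bigr => u _ /=.
by rewrite !mulr_sumr -big_split; apply: eq_bigr => b _ /=; ring.
Qed.

Lemma expect2_mix s x1 b k l p :
  expect2 s x1 b (fun u => p * k u + (1 - p) * l u) =
  p * expect2 s x1 b k + (1 - p) * expect2 s x1 b l.
Proof.
rewrite /expect2 !mulr_sumr -big_split; apply: eq_bigr => u _ /=.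
by rewrite !mulr_sumr -big_split; apply: eq_bigr => a _ /=; ring.
Qed.

Lemma expect_mix s x1 x2 k l p :
  expect s x1 x2 (fun u => p * k u + (1 - p) * l u) =
  p * expect s x1 x2 k + (1 - p) * expect s x1 x2 l.
Proof.
rewrite !expectE1 !mulr_sumr -big_split; apply: eq_bigr => a _ /=.
by rewrite expect1_mix; ring.
Qed.

Lemma expect_itv s x1 x2 k : D1 s x1 -> D2 s x2 ->
  (forall u, 0 <= k u <= 1) -> 0 <= expect s x1 x2 k <= 1.
Proof.
move=> [x1_ge0 _ x1_sum] [x2_ge0 _ x2_sum] k01.
have mixed_ge0 u : 0 <= mixed_delta s x1 x2 u.
  apply: sumr_ge0 => a _; apply: sumr_ge0 => b _.
  by have [d0 _ _] := delta_distr s a b; rewrite !mulr_ge0.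
have mixed_sum : \sum_u mixed_delta s x1 x2 u = 1.
  rewrite /mixed_delta exchange_big -x1_sum; apply: eq_bigr => a _ /=.
  rewrite exchange_big -[RHS]mulr1 -x2_sum mulr_sumr; apply: eq_bigr => b _ /=.
  have [_ _ d1] := delta_distr s a b.
  by rewrite -!mulr_suml d1 mul1r.
apply/andP; split.
  by apply: sumr_ge0 => u _; have /andP[k0 _] := k01 u; rewrite mulr_ge0.
rewrite -mixed_sum; apply: ler_sum => u _; have /andP[_ k1] := k01 u.
by rewrite ler_piMr.
Qed.

Lemma C_neq0 d : directed_metric d -> C d !=set0.
Proof.
move=> [d0 _ _]; exists (fun=> 0); split=> [u|s t]; first by rewrite lexx ler01.
by rewrite subrr.
Qed.

Lemma C_mono d e k : (forall s t, d s t <= e s t) -> C d k -> C e k.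
Proof. by move=> de [k01 kd]; split=> // s t; apply: le_trans (de s t). Qed.

Lemma C_mix d k l p : C d k -> C d l -> 0 <= p <= 1 ->
  C d (fun u => p * k u + (1 - p) * l u).
Proof.
move=> [k01 kd] [l01 ld] /andP[p0 p1]; split=> [u|s t].
  by have := k01 u; have := l01 u; nra.
by have := kd s t; have := ld s t; nra.
Qed.

(** * Bounds on the operators as statements about strategies *)

Lemma Pre1_itv k s : (forall u, 0 <= k u <= 1) -> 0 <= Pre1 k s <= 1.
Proof.
move=> k01; apply: sup_image_itv (D1_neq0 s) _ => x1 Dx1.
by apply: inf_image_itv (D2_neq0 s) _ => x2 Dx2; exact: expect_itv.
Qed.

(** Optima need not be attained, hence the slack [e]: half of it pays for a [y1] nearly optimal at
    [t], half for an [x2] nearly optimal against [x1]. The shape matches [H_posterioriP], with [k]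
    fixed in advance. *)
Lemma Pre1_subP k s t m : (forall u, 0 <= k u <= 1) ->
  Pre1 k s - Pre1 k t <= m <->
  forall x1 e, D1 s x1 -> 0 < e -> exists2 y1, D1 t y1 &
    forall y2, D2 t y2 -> exists2 x2, D2 s x2 &
      expect s x1 x2 k - expect t y1 y2 k <= m + e.
Proof.
move=> k01.
have E0 u x1 x2 : D1 u x1 -> D2 u x2 -> 0 <= expect u x1 x2 k.
  by move=> Dx1 Dx2; case/andP: (expect_itv Dx1 Dx2 k01).
pose V u x1 := inf [set expect u x1 x2 k | x2 in D2 u].
have V1 u x1 : D1 u x1 -> V u x1 <= 1.
  move=> Dx1; have /andP[//] : 0 <= V u x1 <= 1.
  by apply: inf_image_itv (D2_neq0 u) _ => x2 Dx2; exact: expect_itv.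
have V_le u x1 x2 : D1 u x1 -> D2 u x2 -> V u x1 <= expect u x1 x2 k.
  by move=> Dx1 Dx2; apply: (ge_inf_image _ Dx2) => y2 Dy2; exact: E0.
have V_Pre u x1 : D1 u x1 -> V u x1 <= Pre1 k u.
  by move=> Dx1; exact: (le_sup_image (@V1 u) Dx1).
split=> [lem x1 e Dx1 e0|strat].
  have e20 : 0 < e / 2 by lra.
  have [y1 Dy1 y1lt] := sup_image_adherent (D1_neq0 t) (@V1 t) e20.
  exists y1 => // y2 Dy2.
  have [x2 Dx2 x2lt] :=
    inf_image_adherent (D2_neq0 s) (fun x2 => E0 s x1 x2 Dx1) e20.
  exists x2 => //; rewrite -/(V s x1) in x2lt; rewrite -/(Pre1 k t) in y1lt.
  by have := V_le t y1 y2 Dy1 Dy2; have := V_Pre s x1 Dx1; lra.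
rewrite lerBlDr; apply: sup_image_le (D1_neq0 s) _ => x1 Dx1.
apply/ler_addgt0Pr => e e0; have [y1 Dy1 y1P] := strat x1 e Dx1 e0.
have := V_Pre t y1 Dy1.
suff : V s x1 - m - e <= V t y1 by rewrite -/(V s x1); lra.
apply: inf_image_ge (D2_neq0 t) _ => y2 Dy2.
by have [x2 Dx2] := y1P y2 Dy2; have := V_le s x1 x2 Dx1 Dx2; lra.
Qed.

Lemma H_prioriP d s t m : directed_metric d ->
  H_priori d s t <= m <-> obs_dist s t <= m /\
    forall k, C d k -> Pre1 k s - Pre1 k t <= m.
Proof.
move=> dm; rewrite /H_priori ge_max.
have Pre_le1 k : C d k -> Pre1 k s - Pre1 k t <= 1.
  by move=> [k01 _]; have := Pre1_itv s k01; have := Pre1_itv t k01; lra.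
split=> [/andP[-> supm]|[-> lem]]; last first.
  by apply: sup_image_le => //; exact: C_neq0.
by split=> // k Ck; apply: le_trans supm; exact: (le_sup_image Pre_le1 Ck).
Qed.

(** Each supremum becomes a universal quantifier and each infimum an existential one up to [e / 2].
    Taking [m] to be the value of the operator itself extracts near-optimal strategies. *)
Lemma H_posterioriP d s t m : directed_metric d ->
  H_posteriori d s t <= m <-> obs_dist s t <= m /\
    forall x1 e, D1 s x1 -> 0 < e -> exists2 y1, D1 t y1 &
      forall y2, D2 t y2 -> exists2 x2, D2 s x2 &
        forall k, C d k -> expect s x1 x2 k - expect t y1 y2 k <= m + e.
Proof.
move=> dm; rewrite /H_posteriori ge_max.
have C0 := C_neq0 dm.
pose F x1 y1 y2 x2 k := expect s x1 x2 k - expect t y1 y2 k.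
pose F1 x1 y1 y2 x2 := sup [set F x1 y1 y2 x2 k | k in C d].
pose F2 x1 y1 y2 := inf [set F1 x1 y1 y2 x2 | x2 in D2 s].
pose F3 x1 y1 := sup [set F2 x1 y1 y2 | y2 in D2 t].
pose F4 x1 := inf [set F3 x1 y1 | y1 in D1 t].
(* All nested values stay in [-1, 1], so no [sup] or [inf] falls back to its default value. *)
have bF x1 y1 y2 x2 k : D1 s x1 -> D1 t y1 -> D2 t y2 -> D2 s x2 -> C d k ->
    -1 <= F x1 y1 y2 x2 k <= 1.
  move=> Dx1 Dy1 Dy2 Dx2 [k01 _].
  by have := expect_itv Dx1 Dx2 k01; have := expect_itv Dy1 Dy2 k01; rewrite /F; lra.
have bF1 x1 y1 y2 x2 : D1 s x1 -> D1 t y1 -> D2 t y2 -> D2 s x2 ->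
    -1 <= F1 x1 y1 y2 x2 <= 1.
  by move=> *; apply: sup_image_itv => // k Ck; exact: bF.
have bF2 x1 y1 y2 : D1 s x1 -> D1 t y1 -> D2 t y2 -> -1 <= F2 x1 y1 y2 <= 1.
  by move=> *; apply: inf_image_itv (D2_neq0 s) _ => x2 Dx2; exact: bF1.
have bF3 x1 y1 : D1 s x1 -> D1 t y1 -> -1 <= F3 x1 y1 <= 1.
  by move=> *; apply: sup_image_itv (D2_neq0 t) _ => y2 Dy2; exact: bF2.
have bF4 x1 : D1 s x1 -> -1 <= F4 x1 <= 1.
  by move=> *; apply: inf_image_itv (D1_neq0 t) _ => y1 Dy1; exact: bF3.
split=> [/andP[-> supm]|[-> strat]].
  split=> // x1 e Dx1 e0; have e20 : 0 < e / 2 by lra.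
  have F4m : F4 x1 <= m.
    apply: le_trans supm; apply: (@le_sup_image _ _ (D1 s) F4 1) => // y1 Dy1.
    by case/andP: (bF4 y1 Dy1).
  have [|y1 Dy1 y1lt] :=
      @inf_image_adherent _ _ (D1 t) (F3 x1) (-1) _ (D1_neq0 t) _ e20.
    by move=> y1 Dy1; case/andP: (bF3 x1 y1 Dx1 Dy1).
  exists y1 => // y2 Dy2.
  have F2F3 : F2 x1 y1 y2 <= F3 x1 y1.
    apply: (@le_sup_image _ _ (D2 t) (F2 x1 y1) 1) => // z2 Dz2.
    by case/andP: (bF2 x1 y1 z2 Dx1 Dy1 Dz2).
  have [|x2 Dx2 x2lt] :=
      @inf_image_adherent _ _ (D2 s) (F1 x1 y1 y2) (-1) _ (D2_neq0 s) _ e20.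
    by move=> x2 Dx2; case/andP: (bF1 x1 y1 y2 x2 Dx1 Dy1 Dy2 Dx2).
  exists x2 => // k Ck; rewrite -/(F4 x1) in y1lt; rewrite -/(F2 x1 y1 y2) in x2lt.
  have : F x1 y1 y2 x2 k <= F1 x1 y1 y2 x2.
    apply: (@le_sup_image _ _ (C d) (F x1 y1 y2 x2) 1) => // l Cl.
    by case/andP: (bF x1 y1 y2 x2 l Dx1 Dy1 Dy2 Dx2 Cl).
  by rewrite /F; lra.
apply: (@sup_image_le _ _ (D1 s) F4) (D1_neq0 s) _ => x1 Dx1.
apply/ler_addgt0Pr => e e0; have [y1 Dy1 y1P] := strat x1 e Dx1 e0.
apply: (@le_trans _ _ (F3 x1 y1)).
  apply: (@ge_inf_image _ _ (D1 t) (F3 x1) (-1)) => // z1 Dz1.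
  by case/andP: (bF3 x1 z1 Dx1 Dz1).
apply: sup_image_le (D2_neq0 t) _ => y2 Dy2; have [x2 Dx2 x2P] := y1P y2 Dy2.
apply: (@le_trans _ _ (F1 x1 y1 y2 x2)); last exact: sup_image_le.
apply: (@ge_inf_image _ _ (D2 s) (F1 x1 y1 y2) (-1)) => // z2 Dz2.
by case/andP: (bF1 x1 y1 y2 z2 Dx1 Dy1 Dy2 Dz2).
Qed.

(** * Both operators act monotonically on directed metrics *)

Lemma obs_dist_ge0 s t : 0 <= obs_dist s t.
Proof. exact: bigmax_ge_id. Qed.

Lemma obs_dist_le1 s t : obs_dist s t <= 1.
Proof.
apply: bigmax_le => // v _.
by have := obs_itv v s; have := obs_itv v t; rewrite ler_norml; lra.
Qed.

Lemma obs_dist_refl s : obs_dist s s = 0.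
Proof. by apply: bigmax_eq_id => v _; rewrite subrr normr0. Qed.

Lemma obs_dist_triangle s t u : obs_dist s u <= obs_dist s t + obs_dist t u.
Proof.
apply: bigmax_le => [|v _]; first by rewrite addr_ge0 ?obs_dist_ge0.
apply: le_trans (ler_distD (obs v t) _ _) _.
by apply: lerD; apply: (le_bigmax 0 (fun v => `|obs v _ - obs v _|)).
Qed.

Lemma obs_dist_H_priori d s t : obs_dist s t <= H_priori d s t.
Proof. by rewrite /H_priori le_max lexx. Qed.

Lemma obs_dist_H_posteriori d s t : obs_dist s t <= H_posteriori d s t.
Proof. by rewrite /H_posteriori le_max lexx. Qed.

Lemma H_priori_op : metric_operator (@H_priori R G).
Proof.
split=> [d dm|d p dm pm dp s t|d dm s t].
- split=> [s t|s|s t u].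
  + exact: le_trans (obs_dist_ge0 s t) (obs_dist_H_priori d s t).
  + apply/eqP; rewrite eq_le -{2}(obs_dist_refl s) obs_dist_H_priori andbT.
    by apply/H_prioriP => //; rewrite obs_dist_refl; split=> // k _; rewrite subrr.
  + have /(H_prioriP _ _ _ dm)[ost kst] := lexx (H_priori d s t).
    have /(H_prioriP _ _ _ dm)[otu ktu] := lexx (H_priori d t u).
    apply/H_prioriP => //; split=> [|k Ck].
      by apply: le_trans (obs_dist_triangle s t u) _; exact: lerD.
    by have := kst k Ck; have := ktu k Ck; lra.
- apply/H_prioriP => //; have /(H_prioriP _ _ _ pm)[op kp] := lexx (H_priori p s t).
  by split=> // k Ck; apply: kp; exact: C_mono Ck.
- apply/H_prioriP => //; split=> [|k [k01 _]]; first exact: obs_dist_le1.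
  by have := Pre1_itv s k01; have := Pre1_itv t k01; lra.
Qed.

(** Copying moves gives the zero diagonal. The triangle inequality composes strategies: player 1's
    moves pass from [s] through [t] to [u], player 2's replies pass back, and each half spends
    [e / 2]. *)
Lemma H_posteriori_op : metric_operator (@H_posteriori R G).
Proof.
split=> [d dm|d p dm pm dp s t|d dm s t].
- split=> [s t|s|s t u].
  + exact: le_trans (obs_dist_ge0 s t) (obs_dist_H_posteriori d s t).
  + apply/eqP; rewrite eq_le -{2}(obs_dist_refl s) obs_dist_H_posteriori andbT.
    apply/H_posterioriP => //; rewrite obs_dist_refl; split=> // x1 e Dx1 e0.
    exists x1 => // y2 Dy2; exists y2 => // k _.
    by rewrite subrr add0r ltW.
  + have /(H_posterioriP _ _ _ dm)[ost kst] := lexx (H_posteriori d s t).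
    have /(H_posterioriP _ _ _ dm)[otu ktu] := lexx (H_posteriori d t u).
    apply/H_posterioriP => //; split=> [|x1 e Dx1 e0].
      by apply: le_trans (obs_dist_triangle s t u) _; exact: lerD.
    have e20 : 0 < e / 2 by lra.
    have [y1 Dy1 y1P] := kst x1 _ Dx1 e20; have [z1 Dz1 z1P] := ktu y1 _ Dy1 e20.
    exists z1 => // z2 Dz2; have [y2 Dy2 y2P] := z1P z2 Dz2.
    have [x2 Dx2 x2P] := y1P y2 Dy2; exists x2 => // k Ck.
    by have := x2P k Ck; have := y2P k Ck; lra.
- apply/H_posterioriP => //.
  have /(H_posterioriP _ _ _ pm)[op strat] := lexx (H_posteriori p s t).
  split=> // x1 e Dx1 e0; have [y1 Dy1 y1P] := strat x1 e Dx1 e0.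
  exists y1 => // y2 Dy2; have [x2 Dx2 x2P] := y1P y2 Dy2.
  by exists x2 => // k Ck; apply: x2P; exact: C_mono Ck.
- apply/H_posterioriP => //; split=> [|x1 e Dx1 e0]; first exact: obs_dist_le1.
  have [y1 Dy1] := D1_neq0 t; have [x2 Dx2] := D2_neq0 s.
  exists y1 => // y2 Dy2; exists x2 => // k [k01 _].
  by have := expect_itv Dx1 Dx2 k01; have := expect_itv Dy1 Dy2 k01; lra.
Qed.

(** * Comparison of the two operators *)

Lemma H_priori_le_posteriori d : directed_metric d ->
  forall s t, H_priori d s t <= H_posteriori d s t.
Proof.
move=> dm s t.
have /(H_posterioriP _ _ _ dm)[ost strat] := lexx (H_posteriori d s t).
apply/H_prioriP => //; split=> // k Ck; have [k01 _] := Ck.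
apply/Pre1_subP => // x1 e Dx1 e0; have [y1 Dy1 y1P] := strat x1 e Dx1 e0.
exists y1 => // y2 Dy2; have [x2 Dx2 x2P] := y1P y2 Dy2.
by exists x2 => //; exact: x2P.
Qed.

(** Both replies of player 2 are forced, so [y1] is the only choice that depends on [k], and
    [minimax] over [Gamma1 t] makes it uniform. *)
Lemma H_posteriori_le_priori_turn2 d s t : directed_metric d ->
  #|Gamma2 s| = 1%N -> #|Gamma2 t| = 1%N ->
  H_posteriori d s t <= H_priori d s t.
Proof.
move=> dm s1 t1; have /(H_prioriP _ _ _ dm)[ost Pst] := lexx (H_priori d s t).
apply/H_posterioriP => //; split=> // x1 e Dx1 e0.
have [x2 Dx2] := D2_neq0 s; have [y2 Dy2] := D2_neq0 t.
have mixE y1 k : D1 t y1 ->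
    \sum_a y1 a * (expect s x1 x2 k - expect1 t a y2 k) =
    expect s x1 x2 k - expect t y1 y2 k.
  move=> [_ _ y1_sum]; under eq_bigr do rewrite mulrBr.
  by rewrite sumrB -mulr_suml y1_sum mul1r (expectE1 t).
have [||y1 Dy1 y1P] := @minimax R (S -> R) M (Gamma1 t) (C d)
    (fun a k => expect s x1 x2 k - expect1 t a y2 k) (H_priori d s t + e)
    (Gamma1_neq0 t).
- move=> k l p Ck Cl p01; exists (fun u => p * k u + (1 - p) * l u).
    exact: C_mix.
  by move=> a; rewrite expect_mix expect1_mix; ring.
- move=> k Ck; have [k01 _] := Ck.
  have [y1 Dy1 y1P] := (Pre1_subP s t _ k01).1 (Pst k Ck) x1 e Dx1 e0.
  exists y1; rewrite ?mixE //; have [z2 Dz2] := y1P y2 Dy2.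
  by rewrite (distr_card1_unique s1 Dz2 Dx2).
exists y1 => // z2 Dz2; exists x2 => // k Ck.
by rewrite (distr_card1_unique t1 Dz2 Dy2) -mixE //; exact: y1P.
Qed.

(** Here [y1] is forced, and for fixed [x1] and [y2] the reply [x2] is made uniform in [k] by
    [minimax] over [Gamma2 s]. This settles every pair with [t] owned by player 2. *)
Lemma H_posteriori_le_priori_turn1 d s t : directed_metric d ->
  #|Gamma1 t| = 1%N -> H_posteriori d s t <= H_priori d s t.
Proof.
move=> dm t1; have /(H_prioriP _ _ _ dm)[ost Pst] := lexx (H_priori d s t).
apply/H_posterioriP => //; split=> // x1 e Dx1 e0.
have [y1 Dy1] := D1_neq0 t; exists y1 => // y2 Dy2.
have mixE x2 k : D2 s x2 ->
    \sum_b x2 b * (expect2 s x1 b k - expect t y1 y2 k) =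
    expect s x1 x2 k - expect t y1 y2 k.
  move=> [_ _ x2_sum]; under eq_bigr do rewrite mulrBr.
  by rewrite sumrB -mulr_suml x2_sum mul1r (expectE2 s).
have [||x2 Dx2 x2P] := @minimax R (S -> R) M (Gamma2 s) (C d)
    (fun b k => expect2 s x1 b k - expect t y1 y2 k) (H_priori d s t + e)
    (Gamma2_neq0 s).
- move=> k l p Ck Cl p01; exists (fun u => p * k u + (1 - p) * l u).
    exact: C_mix.
  by move=> b; rewrite expect_mix expect2_mix; ring.
- move=> k Ck; have [k01 _] := Ck.
  have [z1 Dz1 z1P] := (Pre1_subP s t _ k01).1 (Pst k Ck) x1 e Dx1 e0.
  have [x2 Dx2 x2P] := z1P y2 Dy2; exists x2; rewrite ?mixE //.
  by rewrite -(distr_card1_unique t1 Dz1 Dy1).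
by exists x2 => // k Ck; rewrite -mixE //; exact: x2P.
Qed.

Lemma H_posteriori_le_priori d : turn_based G -> directed_metric d ->
  forall s t, H_posteriori d s t <= H_priori d s t.
Proof.
move=> [S1 [S2 [S12 _ S1P S2P [turn turnP]]]] dm s t.
have inS u : u \in S1 \/ u \in S2.
  by apply/orP; rewrite -finset.in_setU S12 finset.in_setT.
have [tS1|tS2] := inS t; last exact/H_posteriori_le_priori_turn1/S2P.
have [sS1|sS2] := inS s; first by apply: H_posteriori_le_priori_turn2 => //; exact: S1P.
(* Now [s] is in [S2] and [t] in [S1]: [turn] differs by 1, the upper bound of the a posteriori
   operator. *)
have [_ _ H1] := H_posteriori_op.
apply: le_trans (H1 d dm s t) _; apply: le_trans (obs_dist_H_priori d s t).
apply: le_trans (le_bigmax 0 (fun v => `|obs v s - obs v t|) turn).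
by rewrite ((turnP s).2.2 sS2) ((turnP t).1.2 tS1) sub0r normrN1.
Qed.

End Operators.

(** * A game where the a posteriori metric is strictly larger *)

Section Gap.
Variable R : realType.

(* The states are two sinks [inl b] with observation [b], and two states
   [gap_s] and [gap_t] with observation 1/2. At [gap_s] player 2 either stays or
   moves to a uniformly random sink. At [gap_t] the play reaches the sink
   [inl a] if both players choose [a], and [gap_s] if they choose differently. *)
Definition gap_s : bool + bool := inr true.
Definition gap_t : bool + bool := inr false.

Definition gap_obs (_ : unit) (s : bool + bool) : R :=
  match s with inl b => b%:R | inr _ => 1 / 2 end.

Definition gap_delta (s : bool + bool) (a b : bool) : bool + bool -> R :=
  match s with
  | inl c => dirac R (inl c)
  | inr true => if b then dirac R gap_s
      else fun u => 1 / 2 * dirac R (inl true) u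
                    + (1 - 1 / 2) * dirac R (inl false) u
  | inr false => dirac R (if a == b then inl a else gap_s)
  end.

Lemma gap_obs_itv v s : 0 <= gap_obs v s <= 1.
Proof. by case: s => [[]|b] /=; lra. Qed.

Lemma gap_delta_distr s a b : distr predT (gap_delta s a b).
Proof.
have dP u : distr predT (dirac R u) by exact: distr_dirac.
case: s => [c|[]] /=; [exact: dP| |exact: dP].
by case: b; [exact: dP|apply: distr_mix => //; lra].
Qed.

Lemma boolset_neq0 : [set: bool]%SET != finset.set0.
Proof. by apply/set0Pn; exists true; rewrite inE. Qed.

Definition gap_game : game_structure R :=
  @GameStructure R (bool + bool)%type unit bool gap_obs
    (fun=> [set: bool]%SET) (fun=> [set: bool]%SET) gap_delta
    gap_obs_itv (fun=> boolset_neq0) (fun=> boolset_neq0) gap_delta_distr.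

Local Notation sink1 := (inl true).
Local Notation sink0 := (inl false).

Lemma expect_gap_s x1 x2 (k : bool + bool -> R) :
  \sum_a x1 a = 1 ->
  expect (G := gap_game) gap_s x1 x2 k =
  x2 true * k gap_s + x2 false * ((k sink1 + k sink0) / 2).
Proof.
rewrite big_bool /= => x1_sum.
rewrite /expect /mixed_delta big_sumType /= !big_bool /= /dirac /=.
have -> : x1 true = 1 - x1 false by rewrite -x1_sum; ring.
by rewrite /gap_s /=; field.
Qed.

Lemma expect_gap_t x1 x2 (k : bool + bool -> R) :
  expect (G := gap_game) gap_t x1 x2 k =
  x1 true * (x2 true * k sink1 + x2 false * k gap_s)
  + x1 false * (x2 true * k gap_s + x2 false * k sink0).
Proof.
rewrite /expect /mixed_delta big_sumType /= !big_bool /= /dirac /=.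
by rewrite /gap_s /=; ring.
Qed.

Lemma D1_gapP (s : state gap_game) x :
  D1 s x <-> [/\ 0 <= x true, 0 <= x false & x true + x false = 1].
Proof.
split=> [[x0 _]|[xt xf x1]]; first by rewrite big_bool.
by split=> [[]|a|]; rewrite ?inE ?big_bool.
Qed.

Lemma D2_gapP (s : state gap_game) x :
  D2 s x <-> [/\ 0 <= x true, 0 <= x false & x true + x false = 1].
Proof. exact: D1_gapP. Qed.

Lemma gap_obs_dist : obs_dist (G := gap_game) gap_s gap_t = 0.
Proof. by apply: bigmax_eq_id => v _ /=; rewrite subrr normr0. Qed.

Lemma gap_priori : priori_metric (G := gap_game) gap_s gap_t = 0.
Proof.
have [[dm fixE _] _] := lfp_spec (H_priori_op gap_game).
apply/eqP; rewrite eq_le; apply/andP; split; last by case: dm => d0 _ _; exact: d0.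
rewrite /priori_metric -fixE; apply/H_prioriP => //.
rewrite gap_obs_dist; split=> // k [k01 _].
apply/Pre1_subP => // x1 e Dx1 e0.
(* Player 1 can pick the move leading to the more valuable sink, but only
   because [k] is known. *)
pose a := k sink0 <= k sink1.
exists (dirac R a); first by apply/D1_gapP; rewrite /dirac; case: a => /=; split; lra.
move=> y2 /D2_gapP[y2t y2f y2_sum].
(* At [gap_s] player 2 stays with the probability that [y2] mismatches the move [a]. The
   expectations then differ only in comparing the average of the sinks with the better sink. *)
exists (if a then fun b => if b then y2 false else y2 true else y2).
  by apply/D2_gapP; case: a; split; lra.
have /D1_gapP[_ _ x1_sum] := Dx1.
rewrite expect_gap_s ?big_bool // expect_gap_t /dirac /a.
by clear dm fixE; case: (leP (k sink0) (k sink1)) => /= kk; nra.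
Qed.

(** The observation and its complement both lie in [C d], since the fixpoint dominates [obs_dist],
    and both have expectation 1/2 at [gap_s] whatever [x2] is. At [gap_t] player 2 matches the
    likelier move of [y1]; under the valuation that is 0 at the corresponding sink, the expectation
    is at most 1/4. *)
Lemma gap_posteriori : 0 < posteriori_metric (G := gap_game) gap_s gap_t.
Proof.
have [[dm fixE _] _] := lfp_spec (H_posteriori_op gap_game).
rewrite -/(posteriori_metric (G := gap_game)) in dm fixE.
set d := posteriori_metric (G := gap_game) in dm fixE *.
have d_obs s t : gap_obs tt s - gap_obs tt t <= d s t
    /\ gap_obs tt t - gap_obs tt s <= d s t.
  have : `|gap_obs tt s - gap_obs tt t| <= d s t.
    rewrite -fixE; apply: le_trans (obs_dist_H_posteriori d s t).
    exact: (le_bigmax 0 (fun v => `|obs (g := gap_game) v s - obs v t|) tt).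
  by rewrite ler_norml; lra.
have C_obs : C d (gap_obs tt).
  by split=> [u|s t]; [exact: gap_obs_itv|case: (d_obs s t)].
have C_obsN : C d (fun u => 1 - gap_obs tt u).
  split=> [u|s t]; first by have := gap_obs_itv tt u; lra.
  by have [_] := d_obs s t; lra.
rewrite ltNge; apply/negP; rewrite -fixE => /(H_posterioriP _ _ _ dm)[_ strat].
have Dt : D1 (G := gap_game) gap_s (dirac R true).
  by apply/D1_gapP; rewrite /dirac /=; split; lra.
(* Any positive error below the gap 1/4 would do. *)
have [|y1 /D1_gapP[y1t y1f y1_sum] y1P] := strat _ (1 / 8) Dt; first by lra.
have [half|half] := leP (1 / 2) (y1 true).
  have [|x2 /D2_gapP[x2t x2f x2_sum] /(_ _ C_obsN)] := y1P (dirac R true).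
    by apply/D2_gapP; rewrite /dirac /=; split; lra.
  rewrite expect_gap_s ?expect_gap_t ?big_bool /dirac /=; lra.
have [|x2 /D2_gapP[x2t x2f x2_sum] /(_ _ C_obs)] := y1P (dirac R false).
  by apply/D2_gapP; rewrite /dirac /=; split; lra.
rewrite expect_gap_s ?expect_gap_t ?big_bool /dirac /=; lra.
Qed.

End Gap.

Theorem theorem3p7 (R : realType) :
  [/\ forall (G : game_structure R) (s t : state G),
        priori_metric s t <= posteriori_metric s t,
      exists (G : game_structure R) (s t : state G),
        priori_metric s t = 0 /\ 0 < posteriori_metric s t
    & forall G : game_structure R, turn_based G ->
        priori_metric (G := G) = posteriori_metric (G := G)].
Proof.
split=> [G s t||G turnG].
- apply: lfp_le; [exact: H_priori_op|exact: H_posteriori_op|].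
  exact: H_priori_le_posteriori.
- exists (gap_game R), gap_s, gap_t.
  by split; [exact: gap_priori|exact: gap_posteriori].
- apply/funext => s; apply/funext => t; apply/eqP; rewrite eq_le.
  apply/andP; split; apply: lfp_le.
  + exact: H_priori_op.
  + exact: H_posteriori_op.
  + exact: H_priori_le_posteriori.
  + exact: H_posteriori_op.
  + exact: H_priori_op.
  + by move=> d dm; exact: H_posteriori_le_priori.
Qed.
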